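(* Every cyclically $4$-edge-connected cubic graph $G$ with colouring defect $\operatorname{df}(G)=4$ admits a Berge cover, that is, there exist at most five perfect matchings of $G$ whose union contains every edge of $G$.
   Context: Graphs may have multiple edges and loops. A connected graph is cyclically $k$-edge-connected if the removal of fewer than $k$ edges cannot leave a subgraph with at least two components containing circuits. The colouring defect $\operatorname{df}(G)$ of a bridgeless cubic graph $G$ is the minimum, over all collections $\{M_1,M_2,M_3\}$ of three (not necessarily distinct) perfect matchings of $G$, of the number of edges belonging to none of $M_1,M_2,M_3$. *)

(* Defs.v *)
(* Finite multigraphs with loops.
   A graph is given by a finite vertex type V, a finite edge type E and
   an endpoint map [ends : E -> V * V]; an edge e is a loop iff
   (ends e).1 = (ends e).2.  Parallel edges are allowed. *)
From mathcomp Require Import all_boot.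
Set Implicit Arguments. Unset Strict Implicit. Unset Printing Implicit Defensive.

Section Graphs.
Variables (V E : finType) (ends : E -> V * V).

(* degree of v in the spanning subgraph with edge set F (loops count twice) *)
Definition degIn (F : {set E}) (v : V) : nat :=
  #|[set e in F | (ends e).1 == v]| + #|[set e in F | (ends e).2 == v]|.

Definition cubic : Prop := forall v : V, degIn [set: E] v = 3.

Definition perfect_matching (M : {set E}) : Prop := forall v : V, degIn M v = 1.

Definition adj (S : {set E}) : rel V := fun u v =>
  [exists e, (e \notin S) &&
     ((((ends e).1 == u) && ((ends e).2 == v)) ||
      (((ends e).1 == v) && ((ends e).2 == u)))].

Definition connected_graph : Prop := forall u v : V, connect (adj set0) u v.

Definition edge_adj_in (C : {set E}) : rel E := fun e f =>
  [&& e \in C, f \in C &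
      [|| (ends e).1 == (ends f).1, (ends e).1 == (ends f).2,
          (ends e).2 == (ends f).1 | (ends e).2 == (ends f).2]].

Definition circuit (C : {set E}) : Prop :=
  C != set0 /\
  (forall v : V, degIn C v = 0 \/ degIn C v = 2) /\
  (forall e f, e \in C -> f \in C -> connect (edge_adj_in C) e f).

Definition cyclically_edge_connected (k : nat) : Prop :=
  connected_graph /\
  forall S : {set E}, #|S| < k ->
    ~ (exists C1 C2 : {set E},
         [/\ circuit C1, circuit C2, C1 :&: S = set0, C2 :&: S = set0 &
           exists2 e1, e1 \in C1 & exists2 e2, e2 \in C2 &
             ~~ connect (adj S) (ends e1).1 (ends e2).1]).

Definition uncovered (M1 M2 M3 : {set E}) : nat := #|~: (M1 :|: M2 :|: M3)|.

Definition colouring_defect_is (d : nat) : Prop :=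
  (exists M1 M2 M3, [/\ perfect_matching M1, perfect_matching M2,
                        perfect_matching M3 & uncovered M1 M2 M3 = d]) /\
  (forall M1 M2 M3, perfect_matching M1 -> perfect_matching M2 ->
                    perfect_matching M3 -> d <= uncovered M1 M2 M3).

Definition berge_cover : Prop :=
  exists Ms : seq {set E},
    size Ms <= 5 /\ (forall M, M \in Ms -> perfect_matching M) /\
    (forall e : E, exists2 M, M \in Ms & e \in M).

End Graphs.

(* Main.v *)
Require Import Defs.
From mathcomp Require Import all_boot zify.
Set Implicit Arguments. Unset Strict Implicit. Unset Printing Implicit Defensive.

(** Let E_k be the set of edges lying in exactly k of three perfect matchings M1, M2, M3 that leave |E_0| = 4 edges uncovered. At every vertex, the number of E_0-edges is the number of E_2-edges plus twice the number of E_3-edges, so |E_0| = |E_2| + 2|E_3|. Cyclic connectivity excludes loops, digons and triangles, and |E_3| = 2 would isolate four vertices, so |E_3| <= 1.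

Each g in E_2 is the middle edge of a path e, g, f with e, f in E_0, and some M_i avoids e, f and g. Then e and f lie in a common perfect matching: otherwise Tutte--Berge gives a vertex set T whose removal leaves at least |T| - 2 odd blocks, and cyclic 4-edge-connectivity forces these blocks to be single vertices and e, g, f to be the only edges inside T, so that every perfect matching would contain one of e, g, f. Counting incidences between E_0 and E_2, the four edges of E_0 split into two pairs linked by E_2-edges, and two further perfect matchings suffice. *)

(** * The Tutte--Berge formula *)

(** The points of [A] moved by [f] split into pairs [x], [f x]; deleting one pair changes neither
    the parity nor the fixed points. *)
Lemma odd_card_involutive (V : finType) (f : V -> V) (A : {set V}) :
  involutive f -> {in A, forall x, f x \in A} ->
  odd #|A| = odd #|[set x in A | f x == x]|.
Proof.
move=> fK; have [n] := ubnP #|A|; elim: n A => // n IHn A leAn fA.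
have [x /andP[xA fx]|fix_all] := pickP [pred x | (x \in A) && (f x != x)].
  pose B := A :\ x :\ f x.
  have cB : #|A| = #|B|.+2.
    by rewrite (cardsD1 x A) (cardsD1 (f x) (A :\ x)) xA in_setD1 fx fA.
  have fB : {in B, forall y, f y \in B}.
    move=> y; rewrite !in_setD1 => /and3P[yfx yx yA].
    by rewrite (inj_eq (can_inj fK)) yx fA // andbT -(inj_eq (can_inj fK)) fK.
  rewrite cB /= negbK IHn //; last by rewrite cB in leAn; lia.
  congr (odd #|pred_of_set _|); apply/setP => y; rewrite !inE.
  have [->|] := eqVneq y x; first by rewrite (negPf fx) !andbF.
  by have [->|] := eqVneq y (f x); rewrite // fK [x == _]eq_sym (negPf fx) !andbF.
congr (odd #|pred_of_set _|); apply/setP => y; rewrite !inE.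
by have := fix_all y; rewrite /=; case: (y \in A) => //= /negbFE.
Qed.

Section TutteBerge.
Variables (V : finType) (r : rel V).
Hypothesis r_sym : symmetric r.
Implicit Types (W S : {set V}) (f : {ffun V -> V}).

(* A matching inside W is an involution moving only vertices of W, each to a neighbour; its fixed points are the unmatched vertices. *)
Definition inv_matching W f : bool :=
  [forall x, (f (f x) == x) && ((f x != x) ==> r x (f x) && (x \in W))].

Definition exposed W f := [set x in W | f x == x].

Lemma inv_matchingP W f : reflect
  (involutive f /\ forall x, f x != x -> r x (f x) /\ x \in W)
  (inv_matching W f).
Proof.
apply: (iffP forallP) => [H | [fK fr] x].
  split=> x; first by have /andP[/eqP] := H x.
  by move=> fx; have /andP[_ /implyP /(_ fx) /andP] := H x.
by rewrite fK eqxx /=; apply/implyP => /fr[-> ->].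
Qed.

Lemma inv_matching_id W : inv_matching W (finfun id).
Proof. by apply/inv_matchingP; split=> x; rewrite !ffunE // eqxx. Qed.

Lemma inv_matching_stable W f x : inv_matching W f -> x \in W -> f x \in W.
Proof.
move=> /inv_matchingP[fK fr] xW; have [-> //|nfx] := eqVneq (f x) x.
by have [] := fr (f x); rewrite // fK eq_sym.
Qed.

Lemma odd_exposed W f : inv_matching W f -> odd #|W| = odd #|exposed W f|.
Proof.
move=> mf; apply: odd_card_involutive; first by case/inv_matchingP: mf.
by move=> x; apply: inv_matching_stable.
Qed.

(** For [x] fixed by [f], the pair [y], [f y] is traded for the pair [x], [y], and [f y] becomes
    unmatched. If [f y = y], the third branch is never reached. *)
Definition rematch f x y : {ffun V -> V} :=
  [ffun a => if a == x then y else if a == y then x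
             else if a == f y then a else f a].

Lemma inv_matching_rematch W f x y : inv_matching W f ->
  f x = x -> x != y -> r x y -> x \in W -> y \in W ->
  inv_matching W (rematch f x y).
Proof.
move=> /inv_matchingP[fK fr] fx nxy rxy xW yW.
have fI a b : (f a == f b) = (a == b) by apply: inj_eq; apply: can_inj.
have fyx : f y != x by rewrite -fx fI eq_sym.
apply/inv_matchingP; split=> a; rewrite !ffunE.
  case: (eqVneq a x) => [-> | nax]; first by rewrite eqxx eq_sym (negPf nxy).
  case: (eqVneq a y) => [-> | nay]; first by rewrite eqxx.
  case: (eqVneq a (f y)) => [ay | nafy].
    by rewrite (negPf nax) (negPf nay) ay eqxx.
  have -> : (f a == x) = false by rewrite -fx fI (negPf nax).
  have -> : (f a == y) = false by rewrite -[y]fK fI (negPf nafy).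
  by rewrite fI (negPf nay) fK.
case: (eqVneq a x) => [-> // | nax].
case: (eqVneq a y) => [-> _ | nay]; first by rewrite r_sym.
by case: (eqVneq a (f y)) => [_ | nafy]; [rewrite eqxx | apply: fr].
Qed.

Lemma exposed_rematch W f x y : involutive f ->
  f x = x -> x != y -> x \in W -> y \in W -> f y \in W ->
  exposed W (rematch f x y) = (f y |: exposed W f :\ x) :\ y.
Proof.
move=> fK fx nxy xW yW fyW; have fI := inj_eq (can_inj fK).
have xfy : (x == f y) = false by rewrite -{1}fx fI (negPf nxy).
apply/setP => a; rewrite !inE ffunE.
case: (eqVneq a x) => [-> | nax].
  by rewrite [y == x]eq_sym (negPf nxy) xfy andbF.
case: (eqVneq a y) => [-> | nay] /=; first by rewrite (negPf nxy) andbF.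
by case: (eqVneq a (f y)) => [-> | _] //=; rewrite fyW eqxx.
Qed.

(** * Maximum matchings and Gallai's lemma *)

Section Maximum.
Variables (W : {set V}) (d : nat).
Hypothesis d_min : forall f, inv_matching W f -> d <= #|exposed W f|.

Definition maximum f := inv_matching W f && (#|exposed W f| == d).

(** When every vertex of [W] is exposed by some maximum matching, this is an equivalence on [W], and
    its classes serve as odd blocks. The disjunct [x == y] secures reflexivity. *)
Definition never_both_exposed x y :=
  (x == y) ||
  [forall f, maximum f ==> ~~ ((x \in exposed W f) && (y \in exposed W f))].

Lemma never_both_exposedC x y : never_both_exposed x y = never_both_exposed y x.
Proof.
rewrite /never_both_exposed eq_sym; congr (_ || _).
by apply: eq_forallb => f; rewrite andbC.
Qed.

Lemma never_both_exposedP x y : never_both_exposed x y -> x != y ->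
  forall f, maximum f -> x \in exposed W f -> y \notin exposed W f.
Proof.
move=> /orP[-> // | /forallP H] _ f /(implyP (H f)).
by rewrite negb_and => /orP[/negPf-> | ].
Qed.

(** Otherwise adding the pair [x], [y] to a maximum matching would leave only [d - 2] vertices
    exposed. *)
Lemma adjacent_never_both_exposed x y :
  r x y -> x \in W -> y \in W -> never_both_exposed x y.
Proof.
move=> rxy xW yW; rewrite /never_both_exposed.
have [// | nxy /=] := eqVneq x y.
apply/forallP => f; apply/implyP => /andP[mf /eqP cf].
apply/negP => /andP[]; rewrite !inE xW yW /= => /eqP fx /eqP fy.
have fK : involutive f by case/inv_matchingP: (mf).
have := d_min (inv_matching_rematch mf fx nxy rxy xW yW).
rewrite exposed_rematch // ?fy // -cf (cardsD1 x (exposed W f)).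
rewrite (cardsD1 y (exposed W f :\ x)) !inE xW yW fx fy !eqxx eq_sym nxy.
suff /subset_leq_card : (y |: exposed W f :\ x) :\ y \subset exposed W f :\ x :\ y by lia.
by apply/subsetP => z; rewrite !inE; case: (z == y).
Qed.

(** A neighbour [y] of the exposed vertex [x] is matched, so rematching exposes [f y] instead of [x]
    and the number of exposed vertices stays [d]. *)
Lemma maximum_rematch f x y : maximum f ->
  f x = x -> r x y -> x \in W -> y \in W -> x != y ->
  f y != y /\ maximum (rematch f x y).
Proof.
move=> mxf fx rxy xW yW nxy; have /andP[mf /eqP cf] := mxf.
have fK : involutive f by case/inv_matchingP: (mf).
have nfy : f y != y.
  have := never_both_exposedP (adjacent_never_both_exposed rxy xW yW) nxy mxf.
  by rewrite !inE xW yW fx eqxx; apply.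
split=> //; rewrite /maximum inv_matching_rematch //= exposed_rematch //; last first.
  exact: inv_matching_stable mf yW.
have nyX : y \notin f y |: exposed W f :\ x.
  by rewrite !inE eq_sym (negPf nfy) !andbF.
have := cardsD1 y (f y |: exposed W f :\ x).
rewrite (negPf nyX) add0n => <-; rewrite cardsU1 !inE.
have -> : (f (f y) == f y) = false by rewrite fK eq_sym (negPf nfy).
by rewrite !andbF -cf (cardsD1 x (exposed W f)) !inE xW fx eqxx.
Qed.

(* Gallai's lemma: if [M] exposes both [x] and [z], take a maximum matching [N] exposing [y] that agrees with [M] as much as possible; rematching a vertex [t != y] exposed by [N] only increases the agreement. *)
Lemma never_both_exposed_trans x y z :
  (exists2 f, maximum f & y \in exposed W f) ->
  never_both_exposed x y -> never_both_exposed y z -> never_both_exposed x z.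
Proof.
have [-> // | nxy] := eqVneq x y; have [-> // | nyz] := eqVneq y z.
move=> [N0 mN0 yN0] xy yz; rewrite /never_both_exposed.
have [// | nxz /=] := eqVneq x z.
apply/forallP => M; apply/implyP => mM; apply/negP => /andP[xM zM].
have yM := never_both_exposedP xy nxy mM xM.
pose agree (N : {ffun V -> V}) := [set a | M a == N a].
have [] := @arg_maxnP _ N0 [pred N | maximum N && (y \in exposed W N)] (fun N => #|agree N|).
  by rewrite /= mN0.
move=> N /andP[mN yN] Nmax.
have xN : x \notin exposed W N.
  by move: yN; apply: contraL; apply: never_both_exposedP xy nxy _ mN.
have zN : z \notin exposed W N by apply: never_both_exposedP yz nyz _ mN yN.
(* Both matchings expose [d] vertices. Since [M] exposes [x] and [z], which [N] covers, [N] exposes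
   at least two vertices that [M] covers, and one of them differs from [y]. *)
have [t /andP[tN tM] nty] : exists2 t, (t \in exposed W N) && (t \notin exposed W M) & t != y.
  have cMN : #|exposed W M| = #|exposed W N|.
    by case/andP: mM => _ /eqP->; case/andP: mN => _ /eqP->.
  have := cardsID (exposed W N) (exposed W M).
  have := cardsID (exposed W M) (exposed W N).
  rewrite cMN [exposed W M :&: _]setIC => <- /addnI/eqP.
  have [t Ht|H0] := pickP [pred t | (t \in exposed W N :\: exposed W M) && (t != y)].
    by exists t; case/andP: Ht => //; rewrite inE andbC.
  have /subset_leq_card : exposed W N :\: exposed W M \subset [set y].
    apply/subsetP => t tNM; have := H0 t; rewrite /= tNM /= !inE.
    by move/negbFE.
  have /subset_leq_card : [set x; z] \subset exposed W M :\: exposed W N.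
    rewrite subUset !sub1set !inE; move: xM zM xN zN; rewrite !inE.
    by move=> /andP[-> ->] /andP[-> ->] /= -> ->.
  by rewrite cards1 cards2 nxz => l2 l1 /eqP e; have := leq_trans l2 (leq_trans (eq_leq e) l1).
have [MK Mr] : involutive M /\ forall a, M a != a -> r a (M a) /\ a \in W.
  by apply/inv_matchingP; case/andP: mM.
have [tW Nt] : t \in W /\ N t = t by move: tN; rewrite inE => /andP[-> /eqP].
have nMt : M t != t by move: tM; rewrite inE tW.
have [rt _] := Mr t nMt.
have MtW : M t \in W by apply: inv_matching_stable tW; case/andP: mM.
have [nNs mN'] : N (M t) != M t /\ maximum (rematch N t (M t)).
  by apply: maximum_rematch; rewrite // eq_sym.
set s := M t in nMt rt MtW nNs mN'; have Ms : M s = t by rewrite /s MK.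
have yN' : y \in exposed W (rematch N t s).
  move: yN; rewrite !inE ffunE => /andP[-> /eqP Ny] /=.
  have nys : y != s by apply: contraNneq nNs => <-; rewrite Ny.
  rewrite [y == t]eq_sym (negPf nty) (negPf nys).
  by case: ifP => // _; rewrite Ny.
have := Nmax (rematch N t s); rewrite /= mN' yN' => /(_ isT).
rewrite leqNgt => /negP[]; apply: proper_card; apply/properP; split; last first.
  by exists t; rewrite !inE ?ffunE ?eqxx // Nt.
apply/subsetP => a; rewrite !inE ffunE => /eqP eMN.
case: (eqVneq a t) => [-> // | nat]; case: (eqVneq a s) => [-> | nas]; first by rewrite Ms.
(* Only [N s] could lose agreement; but if [M] and [N] agreed there, then [M (N s) = s], so
   [N s = M s = t], a case already settled. *)
case: (eqVneq a (N s)) => [aNs|_]; last by rewrite eMN.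
have NK : involutive N by case/andP: mN => /inv_matchingP[].
by move: nat; rewrite -[a]MK eMN aNs NK Ms eqxx.
Qed.
End Maximum.

(* The odd blocks of [P] are unions of components of the graph induced on [W :\: S]. *)
Theorem tutte_berge W : exists f S (P : {set {set V}}),
  [/\ inv_matching W f, S \subset W, partition P (W :\: S),
      forall K, K \in P -> odd #|K| /\
        forall x y, x \in K -> y \in W :\: S -> r x y -> y \in K &
      #|exposed W f| + #|S| <= #|P|].
Proof.
have [n] := ubnP #|W|; elim: n W => // n IHn W leWn.
pose f0 := [arg min_(f < finfun id | inv_matching W f) #|exposed W f|].
have [m0 min0] : inv_matching W f0 /\
    forall f, inv_matching W f -> #|exposed W f0| <= #|exposed W f|.
  by rewrite /f0; case: arg_minnP => //; apply: inv_matching_id.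
set d := #|exposed W f0| in min0; have mx0 : maximum W d f0 by rewrite /maximum m0 eqxx.
(* Either some [v] is covered by every maximum matching, and then [v] joins the barrier by
   induction, or every vertex is exposed by some maximum matching. *)
have [v /andP[vW /forallP vcov] | all_exposed] :=
  pickP [pred v | (v \in W) && [forall f, maximum W d f ==> (v \notin exposed W f)]].
  have cW : #|W| = #|W :\ v|.+1 by rewrite (cardsD1 v W) vW.
  have [f [S [P [mf sSW partP oddP leP]]]] : _ := IHn (W :\ v) ltac:(lia).
  have [fK fr] := inv_matchingP _ _ mf.
  have mfW : inv_matching W f.
    by apply/inv_matchingP; split=> // x /fr[-> /setD1P[]].
  have fv : f v = v by apply/eqP/idPn => /fr[_ /setD1P[/eqP]].
  have vS : v \notin S by apply/negP => /(subsetP sSW); rewrite !inE eqxx.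
  have eW : exposed W f = v |: exposed (W :\ v) f.
    by apply/setP => x; rewrite !inE; case: (eqVneq x v) => [->|]; rewrite // vW fv eqxx.
  have ceW : #|exposed W f| = #|exposed (W :\ v) f|.+1.
    by rewrite eW cardsU1 !inE eqxx.
  (* Since [f] exposes [v], it is not maximum in [W]; by parity it exposes at least [d + 2]
     vertices. This surplus pays for the passage from [S] to [v |: S]. *)
  have nd : #|exposed W f| != d.
    have := vcov f; rewrite /maximum mfW /=; case: eqP => //= _.
    by rewrite eW setU11.
  have par : odd #|exposed W f| = odd d by rewrite -(odd_exposed mfW) (odd_exposed m0).
  have led := min0 f mfW.
  exists f0, (v |: S), P; split=> //.
  - by rewrite subUset sub1set vW (subset_trans sSW (subsetDl _ _)).
  - by rewrite -setDDl.
  - by rewrite -setDDl.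
  by move: nd par led leP; rewrite ceW cardsU1 vS -/d; clearbody d; clear; lia.
have mxex x : x \in W -> exists2 f, maximum W d f & x \in exposed W f.
  move=> xW; have := all_exposed x; rewrite /= xW /= => /negbT.
  by rewrite negb_forall => /existsP[f]; rewrite negb_imply negbK => /andP[]; exists f.
(* By Gallai's lemma the relation is transitive here, so the barrier can be empty and the blocks are
   the equivalence classes. *)
have eqvW : {in W & &, equivalence_rel (never_both_exposed W d)}.
  move=> x y z xW yW zW; split; first by rewrite /never_both_exposed eqxx.
  move=> xy; apply/idP/idP; apply: never_both_exposed_trans => //; try exact: mxex.
  by rewrite never_both_exposedC.
pose P := equivalence_partition (never_both_exposed W d) W.
have partP : partition P W by apply: equivalence_partitionP.
have trivP : trivIset P by case/and3P: partP.
have covP : cover P = W by case/and3P: partP => /eqP.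
have blockE K x y : K \in P -> x \in K -> y \in W -> (y \in K) = never_both_exposed W d x y.
  move=> KP xK yW; have xW : x \in W by rewrite -covP; apply/bigcupP; exists K.
  by rewrite -(def_pblock trivP KP xK) pblock_equivalence_partition.
have subPW K x : K \in P -> x \in K -> x \in W.
  by move=> KP xK; rewrite -covP; apply/bigcupP; exists K.
exists f0, set0, P; rewrite setD0 cards0 addn0 sub0set; split=> // [K KP|].
  have stab x y : x \in K -> y \in W -> r x y -> y \in K.
    move=> xK yW rxy; rewrite (blockE K x) // adjacent_never_both_exposed //.
    exact: subPW xK.
  split=> //.
  have [x xK] : exists x, x \in K.
    by apply/set0Pn; apply: contraTneq KP => ->; case/and3P: partP.
  have xW := subPW K x KP xK; have [f mxf xf] := mxex x xW.
  have /andP[mf _] := mxf; have [fK fr] := inv_matchingP _ _ mf.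
  (* A maximum matching exposing [x] maps the block [K] to itself, because adjacent vertices share a
     block, and it exposes no second vertex of [K]. *)
  rewrite (odd_card_involutive fK); last first.
    move=> y yK; have [-> // | nfy] := eqVneq (f y) y; have [ry yW] := fr y nfy.
    by apply: stab ry => //; apply: inv_matching_stable mf yW.
  suff -> : [set y in K | f y == y] = [set x] by rewrite cards1.
  apply/setP => y; rewrite !inE; apply/andP/eqP => [[yK fy]|->]; last first.
    by move: xf; rewrite !inE => /andP[].
  apply/eqP/idPn; rewrite eq_sym => nxy.
  have yW := subPW K y KP yK; have := blockE K x y KP xK yW; rewrite yK => /esym xy.
  by have := never_both_exposedP xy nxy mxf xf; rewrite inE yW fy.
(* Distinct vertices exposed by [f0] lie in distinct blocks, so there are at least [d] blocks. *)
rewrite -/d; have <- : #|pblock P @: exposed W f0| = d.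
  apply: card_in_imset => x y xf yf; have [/setIdP[xW _] /setIdP[yW _]] := (xf, yf).
  move=> /esym eP; apply/eqP/idPn => nxy.
  have xy : never_both_exposed W d x y.
    by rewrite -(pblock_equivalence_partition eqvW) // -/P -eP mem_pblock covP.
  by have := never_both_exposedP xy nxy mx0 xf; rewrite yf.
apply: subset_leq_card; apply/subsetP => _ /imsetP[x /setIdP[xW _] ->].
by rewrite pblock_mem // covP.
Qed.
End TutteBerge.

(** * Circuits and small cuts *)

Section Cuts.
Variables (V E : finType) (ends : E -> V * V).
Implicit Types (F C D : {set E}) (X : {set V}).

Definition inside X := [set e | ((ends e).1 \in X) && ((ends e).2 \in X)].
Definition boundary X := [set e | ((ends e).1 \in X) (+) ((ends e).2 \in X)].
Definition touched F := [set v | degIn ends F v != 0].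

Lemma degInE F v :
  degIn ends F v = \sum_(e in F) (((ends e).1 == v) + ((ends e).2 == v)).
Proof.
have card_sum (p : E -> V) : #|[set e in F | p e == v]| = \sum_(e in F) (p e == v).
  by rewrite -sum1dep_card big_mkcondr; apply: eq_bigr => e _; case: (_ == _).
by rewrite big_split -!card_sum.
Qed.

Lemma boundaryC X : boundary (~: X) = boundary X.
Proof. by apply/setP => e; rewrite !inE addbN addNb negbK. Qed.

(** Double counting: an edge contributes once for each of its ends in [X], and a loop contributes
    twice. *)
Lemma sum_degIn F X :
  \sum_(v in X) degIn ends F v = #|F :&: inside X|.*2 + #|F :&: boundary X|.
Proof.
have sum_fiber (p : E -> V) :
    \sum_(v in X) #|[set e in F | p e == v]| = #|[set e in F | p e \in X]|.
  rewrite -sum1dep_card (partition_big p (mem X)) /=; last by move=> e /andP[].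
  apply: eq_bigr => v vX; rewrite -sum1dep_card; apply: eq_bigl => e.
  by case: eqP => [->|]; rewrite ?vX ?andbT ?andbF.
rewrite big_split /= !sum_fiber -cardsUI.
set A := [set e in F | (ends e).1 \in X]; set B := [set e in F | (ends e).2 \in X].
have -> : A :&: B = F :&: inside X.
  by apply/setP => e; rewrite !inE; do 3?case: (_ \in _).
have -> : A :|: B = (F :&: boundary X) :|: (F :&: inside X).
  by apply/setP => e; rewrite !inE; do 3?case: (_ \in _).
have := cardsUI (F :&: boundary X) (F :&: inside X).
rewrite [X in _ + #|pred_of_set X|](_ : _ = set0) ?cards0 ?addn0 => [->|]; first by lia.
by apply/setP => e; rewrite !inE; do 3?case: (_ \in _).
Qed.

Lemma sum_degIn_all F : \sum_v degIn ends F v = #|F|.*2.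
Proof.
have := sum_degIn F setT.
have -> : F :&: inside setT = F by apply/setP => e; rewrite !inE /= andbT.
have -> : F :&: boundary setT = set0 by apply/setP => e; rewrite !inE /= andbF.
by rewrite cards0 addn0 => <-; apply: eq_bigl => v; rewrite inE.
Qed.

Lemma sum_degIn_touched F : \sum_(v in touched F) degIn ends F v = #|F|.*2.
Proof.
rewrite -sum_degIn_all [RHS](bigID (mem (touched F))) /=.
by rewrite [X in _ = _ + X]big1 ?addn0 // => v; rewrite inE negbK => /eqP.
Qed.

Lemma touchedP F v :
  reflect (exists2 e, e \in F & ((ends e).1 == v) || ((ends e).2 == v))
          (v \in touched F).
Proof.
rewrite inE /degIn addn_eq0 negb_and !cards_eq0.
apply: (iffP orP) => [[]/set0Pn[e /setIdP[eF ev]] | [e eF /orP[ev|ev]]].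
- by exists e; rewrite ?ev.
- by exists e; rewrite ?ev ?orbT.
- by left; apply/set0Pn; exists e; rewrite inE eF.
- by right; apply/set0Pn; exists e; rewrite inE eF.
Qed.

Lemma touchedS F D : F \subset D -> touched F \subset touched D.
Proof.
move=> sFD; apply/subsetP => v /touchedP[e eF ev].
by apply/touchedP; exists e; rewrite ?(subsetP sFD).
Qed.

(* A minimal nonempty edge set spanning at most as many vertices as it has edges is a circuit. *)
Lemma exists_circuit F : F != set0 -> #|touched F| <= #|F| ->
  exists2 C : {set E}, C \subset F & circuit ends C.
Proof.
move=> F0 leF; pose dense C := (C != set0) && (#|touched C| <= #|C|).
have [|C /minsetP[/andP[C0 leC] minC] sCF] := @minset_exists _ dense F.
  by rewrite /dense F0.
have tC_gt0 : 0 < #|touched C|.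
  have [e eC] := set0Pn _ C0; apply/card_gt0P; exists (ends e).1.
  by apply/touchedP; exists e; rewrite ?eqxx.
have not_dense D : D \subset C -> D != C -> ~~ dense D.
  by move=> sDC; apply: contraNN => /minC ->.
(* Minimality: deleting [e] either empties [C] or leaves fewer edges than touched vertices. *)
have drop e : e \in C -> #|C| = 1 \/ #|C| <= #|touched (C :\ e)|.
  move=> eC; have cC := cardsD1 e C; rewrite eC in cC.
  have /not_dense : C :\ e \subset C by apply: subsetDl.
  have -> : C :\ e != C by apply: contraTneq eC => <-; rewrite !inE eqxx.
  rewrite /dense negb_and negbK -ltnNge -cards_eq0 => /(_ isT)/orP[/eqP|]; first by left; lia.
  by right; rewrite cC.
have cC : #|C| = #|touched C|.
  apply/eqP; rewrite eqn_leq leC andbT; have [e eC] := set0Pn _ C0.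
  have [-> // | /leq_trans] := drop e eC; apply.
  by apply/subset_leq_card/touchedS/subsetDl.
(* At a vertex of degree 1, deleting its edge would lose a vertex as well, contrary to [drop]. The
   degree sum [2 * #|C|] then forces every degree to be exactly 2. *)
have deg2 v : v \in touched C -> 1 < degIn ends C v.
  move=> vC; rewrite ltnNge; apply/negP => dv1.
  have dv : degIn ends C v = 1 by move: vC dv1; rewrite inE; lia.
  have := sum_degIn_touched C; rewrite (bigD1 v) //= dv.
  have [e eC ev] := touchedP _ _ vC.
  have [C1 | leCt] := drop e eC.
    rewrite big1 ?C1 // => w /andP[wC nwv].
    have : [set v; w] \subset touched C by rewrite subUset !sub1set vC wC.
    by move/subset_leq_card; rewrite cards2 eq_sym nwv -cC C1.
  move=> _; have : touched (C :\ e) \subset touched C :\ v.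
    apply/subsetP => w wCe; rewrite in_setD1 (subsetP (touchedS (subsetDl C [set e]))) // andbT.
    apply: contraTneq wCe => ->; rewrite inE negbK.
    by have := dv; rewrite !degInE (big_setD1 e) //=; case/orP: ev => ->; lia.
  move/subset_leq_card; have := cardsD1 v (touched C); rewrite vC; lia.
exists C => //; split=> //; split.
  move=> v; case: (posnP (degIn ends C v)) => [|dv0]; [by left | right].
  have vC : v \in touched C by rewrite inE -lt0n.
  have := sum_degIn_touched C; rewrite (bigD1 v) //= => eqd.
  have : \sum_(i in touched C | i != v) 2 <= \sum_(i in touched C | i != v) degIn ends C i.
    by apply: leq_sum => i /andP[/deg2].
  have -> : \sum_(i in touched C | i != v) 2 = #|touched C :\ v| * 2.
    by rewrite -sum_nat_const; apply: eq_bigl => i; rewrite in_setD1 andbC.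
  by have := cardsD1 v (touched C); have := deg2 v vC; rewrite vC; move: eqd cC; lia.
move=> e f eC fC; apply/idPn => nef.
(* If the component [D] of [e] were proper, [D] and its complement in [C] would each touch more
   vertices than they have edges. These vertex sets are disjoint, so [C] would do the same. *)
pose D := [set g in C | connect (edge_adj_in ends C) e g].
have sDC : D \subset C by rewrite /D setIdE subsetIl.
have nD : ~~ dense D.
  by apply: not_dense => //; apply: contraTneq fC => <-; rewrite inE (negPf nef) andbF.
have nD' : ~~ dense (C :\: D).
  apply: not_dense; first exact: subsetDl.
  by apply: contraTneq eC => <-; rewrite !inE connect0 andbT andNb.
have D0 : D != set0 by apply/set0Pn; exists e; rewrite inE eC connect0.
have D0' : C :\: D != set0 by apply/set0Pn; exists f; rewrite !inE fC negb_and nef orbT.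
have disj : [disjoint touched D & touched (C :\: D)].
  apply/pred0P => v; apply/negP => /andP[/touchedP[g /setIdP[gC cg] gv]].
  move=> /touchedP[h /setDP[hC]]; rewrite inE hC /= => /negP nh hv; apply: nh.
  apply: (connect_trans cg); apply: connect1; rewrite /edge_adj_in gC hC /=.
  by case/orP: gv => /eqP->; case/orP: hv => /eqP->; rewrite eqxx ?orbT.
have := subset_leq_card (_ : touched D :|: touched (C :\: D) \subset touched C).
rewrite subUset !touchedS ?subsetDl // => /(_ isT).
have := leq_card_setU (touched D) (touched (C :\: D)); rewrite disj => -[_ /eqP->].
move: nD nD'; rewrite /dense D0 D0' /= -!ltnNge.
by have := cardsID D C; rewrite (setIidPr sDC) cC; clear; lia.
Qed.

Lemma exists_circuit_inside X : 0 < #|X| -> #|X| <= #|inside X| ->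
  exists2 C : {set E}, C \subset inside X & circuit ends C.
Proof.
move=> X0 leX; apply: exists_circuit; first by rewrite -card_gt0 (leq_trans X0).
apply: leq_trans leX; apply/subset_leq_card/subsetP => v /touchedP[e].
by rewrite inE => /andP[e1 e2] /orP[]/eqP<-.
Qed.

Lemma connect_boundary X u v :
  connect (adj ends (boundary X)) u v -> (u \in X) = (v \in X).
Proof.
apply: closed_connect => {}u {}v /existsP[e]; rewrite inE.
by case/andP=> /negPf Xe /orP[]/andP[/eqP<- /eqP<-]; move: Xe; do 2?case: (_ \in X).
Qed.

(** * Edge cuts in cyclically 4-edge-connected cubic graphs *)

Section CyclicallyConnected.
Hypotheses (cub : cubic ends) (cyc : cyclically_edge_connected ends 4).

Lemma cubic_sum X : 3 * #|X| = #|inside X|.*2 + #|boundary X|.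
Proof.
have := sum_degIn setT X; rewrite !setTI => <-.
by rewrite (eq_bigr _ (fun v _ => cub v)) sum_nat_const mulnC.
Qed.

(** By [cubic_sum], a boundary no larger than [X] leaves at least [#|X|] edges inside [X], hence a
    circuit. The same holds for the complement, and removing the boundary separates the two
    circuits. *)
Lemma no_small_cut X : 0 < #|X| -> 0 < #|~: X| ->
  #|boundary X| < 4 -> #|boundary X| <= #|X| -> #|boundary X| <= #|~: X| -> False.
Proof.
move=> X0 Y0 b4 bX bY; have [_ /(_ (boundary X) b4)] := cyc; apply.
have [|C1 sC1 circ1] := exists_circuit_inside X0; first by have := cubic_sum X; lia.
have [|C2 sC2 circ2] := exists_circuit_inside Y0.
  by have := cubic_sum (~: X); rewrite boundaryC; lia.
have [[/set0Pn[e1 e1C] _] [/set0Pn[e2 e2C] _]] := (circ1, circ2).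
exists C1, C2; split=> //.
- apply/setP => e; rewrite in_set0 in_setI; apply/negP => /andP[/(subsetP sC1)].
  by rewrite !inE => /andP[-> ->].
- apply/setP => e; rewrite in_set0 in_setI; apply/negP => /andP[/(subsetP sC2)].
  by rewrite !inE; do 2!case: (_ \in X).
exists e1 => //; exists e2 => //; apply/negP => /connect_boundary.
have := subsetP sC1 e1 e1C; have := subsetP sC2 e2 e2C; rewrite !inE.
by move=> /andP[/negPf-> _] /andP[-> _].
Qed.

(** With [#|X|] or more edges inside, the boundary would have at most [#|X| <= 3] edges. This is the
    form in which loops, digons and triangles are excluded. *)
Lemma small_sparse X : 0 < #|X| <= 3 -> #|X| <= #|~: X| -> #|inside X| < #|X|.
Proof.
move=> /andP[X0 X3] leX; rewrite ltnNge; apply/negP => dense.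
by have := cubic_sum X; move=> eqX; apply: (@no_small_cut X); lia.
Qed.

(* Equality holds when [X] is a single vertex, where the two cardinals are 1 and 3. *)
Lemma boundary_block M X : perfect_matching ends M -> odd #|X| -> 3 <= #|~: X| ->
  #|M :&: boundary X| + 8 <= 3 * #|boundary X|.
Proof.
move=> pmM oddX leY; have leM : #|M :&: boundary X| <= #|X|.
  have := sum_degIn M X; rewrite (eq_bigr _ (fun v _ => pmM v)) sum1_card; lia.
have := subset_leq_card (subsetIr M (boundary X)).
(* The boundary has the parity of [X], so it is odd. From 5 edges on, the bound by the whole
   boundary suffices; fewer edges are possible only for a single vertex, which carries no loop and
   sends 3 edges out. *)
have := cubic_sum X; have := @no_small_cut X; have := @small_sparse X.
by move: oddX leY leM; move: #|X| #|~: X| #|inside X| #|boundary X| #|M :&: _|; clear; lia.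
Qed.
End CyclicallyConnected.
End Cuts.

(** * Perfect matchings through the ends of a path *)

Section Extension.
Variables (V E : finType) (ends : E -> V * V).
Implicit Types (F M : {set E}) (X T : {set V}).

Lemma adj_sym F : symmetric (adj ends F).
Proof. by move=> u v; apply: eq_existsb => e; rewrite orbC. Qed.

(** One edge is picked for each pair [x], [f x]. With parallel edges both ends must pick the same
    one, which holds because [joins] is symmetric in [x] and [f x]. *)
Lemma edges_of_involution (W : {set V}) (f : V -> V) : involutive f ->
  (forall x, f x != x -> adj ends set0 x (f x) /\ x \in W) ->
  {in W, forall x, f x != x} ->
  exists M, forall v, degIn ends M v = (v \in W).
Proof.
move=> fK fr fW.
pose joins x e := (((ends e).1 == x) && ((ends e).2 == f x)) ||
                  (((ends e).1 == f x) && ((ends e).2 == x)).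
pose M := [set e | [exists x in W, [pick e' | joins x e'] == Some e]].
have pick_f x : [pick e' | joins (f x) e'] = [pick e' | joins x e'].
  by apply: eq_pick => e; rewrite /joins fK orbC.
have WP x : x \in W -> exists2 e, [pick e' | joins x e'] = Some e & joins x e.
  move=> xW; case: pickP => [e xe | none]; first by exists e.
  have [/existsP[e /andP[_ xe]] _] := fr x (fW x xW).
  by have := none e; rewrite /= /joins xe.
have MP e v : e \in M -> ((ends e).1 == v) || ((ends e).2 == v) ->
    v \in W /\ [pick e' | joins v e'] = Some e.
  rewrite inE => /existsP[x /andP[xW /eqP pe]] ev.
  have [e' pe' xe] := WP x xW; move: pe' xe; rewrite pe => -[<-] {e'} xe.
  have [-> | ->] : v = x \/ v = f x.
    by case/orP: ev => /eqP<-; case/orP: xe => /andP[/eqP e1 /eqP e2]; rewrite ?e1 ?e2; auto.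
  - by [].
  - by rewrite pick_f; split=> //; have [] := fr (f x); rewrite // fK eq_sym fW.
exists M => v; rewrite degInE; have [vW | nvW] := boolP (v \in W); last first.
  rewrite big1 // => e eM; apply/eqP; rewrite addn_eq0 !eqb0 -negb_or.
  by apply: contra nvW => /(MP e v eM)[].
have [e pe ve] := WP v vW.
have eM : e \in M by rewrite inE; apply/existsP; exists v; rewrite vW pe eqxx.
rewrite (bigD1 e) //= big1 ?addn0; last first.
  move=> e' /andP[e'M]; apply: contraNeq; rewrite addn_eq0 !eqb0 -negb_or negbK.
  by case/(MP e' v e'M) => _; rewrite pe => -[->].
have nfv := fW v vW; case/orP: ve => /andP[/eqP-> /eqP->]; by rewrite eqxx (negPf nfv).
Qed.

(** No edge joins two different blocks, so every edge leaving [T] lies in the boundary of exactly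
    one block, and edges within [T] or off [T] lie in none. *)
Lemma card_boundary_partition (T : {set V}) (P : {set {set V}}) F :
  partition P (~: T) ->
  (forall K, K \in P -> forall x y, x \in K -> y \in ~: T -> adj ends set0 x y -> y \in K) ->
  #|F :&: boundary ends T| = \sum_(K in P) #|F :&: boundary ends K|.
Proof.
move=> /and3P[/eqP covP trivP _] closedP.
have cardI A : #|F :&: A| = \sum_(e in F) (e \in A : nat).
  rewrite -sum1_card (eq_bigl _ _ (fun e => in_setI e F A)) big_mkcondr.
  by apply: eq_bigr => e _; case: (e \in A).
rewrite cardI (eq_bigr _ (fun K _ => cardI (boundary ends K))) exchange_big /=.
apply: eq_bigr => e _; rewrite inE.
have inT z K : K \in P -> z \in T -> z \in K = false.
  move=> KP zT; apply/negP => zK.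
  by have : z \in cover P; [apply/bigcupP; exists K | rewrite covP inE zT].
have sum_in z : \sum_(K in P) (z \in K : nat) = (z \notin T).
  have [zT | zT] := boolP (z \in T); first by rewrite big1 // => K KP; rewrite inT.
  have zP : z \in cover P by rewrite covP inE.
  rewrite (bigD1 (pblock P z)) ?pblock_mem //= mem_pblock zP big1 ?addn0 //.
  move=> K /andP[KP nK]; case: (boolP (z \in K)) => // zK.
  by rewrite (def_pblock trivP KP zK) eqxx in nK.
have adj_e : adj ends set0 (ends e).1 (ends e).2.
  by apply/existsP; exists e; rewrite inE !eqxx.
have adj_e' : adj ends set0 (ends e).2 (ends e).1 by rewrite adj_sym.
case: (boolP ((ends e).2 \in T)) => e2T.
  rewrite addbT -sum_in; apply: eq_bigr => K KP.
  by rewrite inE (inT _ _ KP e2T) addbF.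
case: (boolP ((ends e).1 \in T)) => e1T.
  have := sum_in (ends e).2; rewrite e2T => <-; apply: eq_bigr => K KP.
  by rewrite inE (inT _ _ KP e1T) addFb.
rewrite big1 // => K KP; rewrite inE; apply/eqP; rewrite eqb0 negb_add.
apply/eqP; apply/idP/idP => eK; apply: (closedP K KP _ _ eK) => //; by rewrite inE.
Qed.

Hypotheses (cub : cubic ends) (cyc : cyclically_edge_connected ends 4).

Lemma cubic_even : odd #|V| = false.
Proof.
have := cubic_sum cub setT; rewrite cardsT => eqV.
have : boundary ends setT = set0 by apply/setP => e; rewrite !inE.
by move=> bT; rewrite bT cards0 in eqV; lia.
Qed.

(* If no perfect matching contains both [e] and [f], a Tutte--Berge barrier makes the graph bipartite up to the edges [e], [f], [g], and counting shows that every perfect matching meets these three edges. *)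
Lemma matching_through_path M (e f g : E) (a b : V) :
  6 <= #|V| -> perfect_matching ends M ->
  e \notin M -> f \notin M -> g \notin M -> e != f -> e != g -> f != g ->
  a != b -> ((ends g).1 == a) || ((ends g).2 == a) ->
  ((ends g).1 == b) || ((ends g).2 == b) ->
  ((ends e).1 == a) || ((ends e).2 == a) ->
  ((ends f).1 == b) || ((ends f).2 == b) ->
  exists N, [/\ perfect_matching ends N, e \in N & f \in N].
Proof.
move=> V6 pmM eM fM gM nef neg nfg nab ga gb ea fb.
pose s := [:: (ends e).1; (ends e).2; (ends f).1; (ends f).2].
pose X := [set v in s].
have pathX : [set e; f; g] \subset inside ends X.
  rewrite !subUset !sub1set !inE !eqxx ?orbT /=.
  by move: ga gb ea fb nab; do 4![case/orP=> /eqP<-]; rewrite !eqxx ?orbT.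
have c3 : #|[set e; f; g]| = 3.
  by rewrite setUC cardsU1 cards2 !inE nef negb_or eq_sym neg eq_sym nfg.
have in3 := subset_leq_card pathX; rewrite c3 in in3.
have X0 : 0 < #|X| by apply/card_gt0P; exists (ends e).1; rewrite !inE eqxx.
(* Three edges on at most three vertices would contradict [small_sparse], so the four ends listed in
   [s] are distinct. *)
have cX : #|X| = 4.
  have : #|X| <= 4 by rewrite cardsE; apply: card_size.
  have := small_sparse cub cyc (X := X); have := cardsC X.
  by move: X0 in3 V6; clear; lia.
have us : uniq s by apply/card_uniqP; move: cX; rewrite cardsE => ->.
have evV := cubic_even.
have cXC : #|~: X| = #|V| - 4 by rewrite -(cardsC X) cX addKn.
have [f0 [S [P [m0 sSW partP blockP leP]]]] := tutte_berge (@adj_sym set0) (~: X).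
have [fK fr] := inv_matchingP _ _ _ m0.
have par := odd_exposed m0.
have [ex0 | exn0] := eqVneq (exposed (~: X) f0) set0.
  have [|N0 N0P] := edges_of_involution fK fr.
    move=> x xX; apply/negP => fx; have : x \in exposed (~: X) f0 by rewrite inE xX.
    by rewrite ex0 inE.
  have notin h : h \in [:: e; f] -> h \notin N0.
    move=> h_ef; apply/negP => hN.
    have : (ends h).1 \in touched ends N0 by apply/touchedP; exists h; rewrite ?eqxx.
    rewrite inE N0P !inE.
    by move: h_ef; rewrite !inE => /orP[]/eqP->; rewrite eqxx ?orbT.
  exists (e |: (f |: N0)); split; rewrite ?inE ?eqxx ?orbT // => v.
  rewrite degInE big_setU1 ?big_setU1 ?inE ?negb_or ?nef ?notin ?inE ?eqxx ?orbT //=.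
  rewrite -degInE N0P !inE.
  have := count_uniq_mem v us; rewrite /= addn0 !addnA => ->.
  by rewrite !inE; case: (_ || _).
(* Here [f0] exposes some vertex, hence at least two because [~: X] is even. This makes the number
   of blocks at least [#|S| + 2], that is [#|T| - 2]. *)
pose T := X :|: S.
have TC : ~: T = ~: X :\: S by rewrite setCU setDE.
have cT : #|T| = #|S| + 4.
  rewrite cardsU cX [_ :&: _](_ : _ = set0) ?cards0 ?subn0 1?addnC //.
  apply/setP => v; rewrite in_set0 in_setI; apply/negP => /andP[vX vS].
  by have := subsetP sSW v vS; rewrite in_setC vX.
rewrite -TC in partP blockP.
have sumP F : #|F :&: boundary ends T| = \sum_(K in P) #|F :&: boundary ends K|.
  by apply: card_boundary_partition => // K /blockP[].
have le_sum : #|M :&: boundary ends T| + 8 * #|P| <= 3 * #|boundary ends T|.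
  rewrite -[boundary ends T in X in _ <= X]setTI !sumP mulnC -sum_nat_const -big_split big_distrr /=.
  apply: leq_sum => K KP; rewrite setTI; apply: boundary_block => //; first by case/blockP: KP.
  have sTK : T \subset ~: K.
    rewrite -[T]setCK setCS; case/and3P: partP => /eqP<- _ _; exact: bigcup_sup.
  by have := subset_leq_card sTK; rewrite cT; clear; lia.
(* Let [T] have [i] inside edges, [j] of them in [M]. Eliminating the boundary terms and [#|T|] from
   [le_sum] and the two degree sums gives [6 * i <= 2 * j + 16]. As [e], [f], [g] are inside and not
   in [M], [j + 3 <= i]; so [i <= 2], yet [i >= 3]. *)
have := cubic_sum cub T.
have := sum_degIn ends M T; rewrite (eq_bigr _ (fun v _ => pmM v)) sum1_card.
have : #|M :&: inside ends T| + 3 <= #|inside ends T|.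
  rewrite -c3 addnC -cardsUI.
  rewrite [X in _ + #|pred_of_set X|](_ : _ = set0) ?cards0 ?addn0; last first.
    apply/setP => h; rewrite !inE; apply/negP => /andP[hefg /andP[hM _]].
    by move: hM; apply/negP; case/orP: hefg => [/orP[]|] /eqP->.
  apply/subset_leq_card; rewrite subUset subsetIr andbT (subset_trans pathX) //.
  by apply/subsetP => h; rewrite !inE => /andP[-> ->].
have : 2 <= #|exposed (~: X) f0|.
  move: exn0 par evV V6; rewrite -cards_eq0 cXC; clear; lia.
by move: le_sum leP cT; clear; lia.
Qed.
End Extension.

(** * Edges covered k times *)

Section Layers.
Variables (V E : finType) (ends : E -> V * V).
Hypotheses (cub : cubic ends) (cyc : cyclically_edge_connected ends 4).
Local Notation incident e v := (((ends e).1 == v) || ((ends e).2 == v)).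

Lemma degIn_unique (F : {set E}) v e e' : degIn ends F v <= 1 ->
  e \in F -> e' \in F -> incident e v -> incident e' v -> e = e'.
Proof.
move=> dF eF e'F ev e'v; apply/eqP/idPn => nee'; move: dF.
rewrite degInE (bigD1 e) //= (bigD1 e') /=; last by rewrite e'F eq_sym.
by case/orP: ev => ->; case/orP: e'v => ->; lia.
Qed.

Lemma cubic_card : 3 * #|V| = #|E|.*2.
Proof.
have := sum_degIn_all ends setT; rewrite (eq_bigr _ (fun v _ => cub v)).
by rewrite sum_nat_const cardsT => <-; rewrite mulnC.
Qed.

Lemma loopless e : 2 <= #|V| -> (ends e).1 != (ends e).2.
Proof.
move=> V2; apply/eqP => eq_ends; have := cardsC [set (ends e).1].
have := small_sparse cub cyc (X := [set (ends e).1]).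
rewrite !cards1 => sparse cV; have /sparse := erefl : 0 < 1 <= 3.
have -> : 1 <= #|~: [set (ends e).1]| by lia.
move=> /(_ isT); rewrite ltnS leqn0 cards_eq0 => /eqP/setP/(_ e).
by rewrite !inE -eq_ends eqxx.
Qed.

Lemma no_parallel e f u v : 4 <= #|V| -> u != v -> incident e u -> incident e v ->
  incident f u -> incident f v -> e = f.
Proof.
move=> V4 nuv eu ev fu fv; apply/eqP/idPn => nef.
have := small_sparse cub cyc (X := [set u; v]); have := cardsC [set u; v].
rewrite !cards2 nuv => cV /(_ isT); have -> : 1.+1 <= #|~: [set u; v]|.
  by move: cV V4; clear; lia.
move=> /(_ isT); rewrite ltnNge => /negP; apply.
have <- : #|[set e; f]| = 2 by rewrite cards2 nef.
have ins h : incident h u -> incident h v -> h \in inside ends [set u; v].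
  rewrite !inE => /orP[]/eqP hu /orP[]/eqP hv; rewrite ?hu ?hv ?eqxx ?orbT //.
    by rewrite -hu -hv eqxx in nuv.
  by rewrite -hu -hv eqxx in nuv.
by apply/subset_leq_card; rewrite subUset !sub1set !ins.
Qed.

(** Exactly one edge joins the ends of [e], so four edges leave this pair; the degree count on the
    other two vertices then yields an edge [f] joining them. *)
Lemma edge_in_matching e : #|V| = 4 -> exists2 N, perfect_matching ends N & e \in N.
Proof.
move=> V4; have lp h : (ends h).1 != (ends h).2 by apply: loopless; rewrite V4.
pose X := [set (ends e).1; (ends e).2].
have cX : #|X| = 2 by rewrite cards2 lp.
have cXC : #|~: X| = 2 by have := cardsC X; lia.
have eX : e \in inside ends X by rewrite !inE !eqxx orbT.
have : #|inside ends X| < 2 by rewrite -cX small_sparse ?cX ?cXC.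
have : 0 < #|inside ends X| by apply/card_gt0P; exists e.
have := cubic_sum cub X; have := cubic_sum cub (~: X); rewrite boundaryC cX cXC => eqXC eqX i0 i2.
have /card_gt0P[f] : 0 < #|inside ends (~: X)| by lia.
rewrite !inE !negb_or => /andP[/andP[n11 n12] /andP[n21 n22]].
pose s := [:: (ends e).1; (ends e).2; (ends f).1; (ends f).2].
have us : uniq s.
  rewrite /s /= !inE !negb_or !lp.
  by move: n11 n12 n21 n22; do 4![rewrite eq_sym => ->].
have nef : e != f by apply: contraNneq n11 => ->; rewrite eqxx.
exists [set e; f] => [v|]; last by rewrite !inE eqxx.
have cs : #|s| = #|{: V}| by move/card_uniqP: (us) => ->; rewrite V4.
have vs : v \in s by rewrite (subset_cardP cs (subset_predT _)).
rewrite degInE big_setU1 ?inE //= big_set1.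
by have := count_uniq_mem v us; rewrite vs /= addn0 !addnA.
Qed.

(** A graph of order at most 2 has at most 3 edges. In order 4 there are 6 edges, and [M1] with a
    matching through an edge outside it covers at least 3, so the defect is at most 3. *)
Lemma order_ge6 d : 4 <= d -> colouring_defect_is ends d -> 6 <= #|V|.
Proof.
move=> d4 [[M1 [M2 [M3 [pm1 pm2 pm3 def]]]] defmin].
have evV := cubic_even cub; have cE := cubic_card.
have dE : d <= #|E| by rewrite -def max_card.
have [V4 | ] : #|V| = 4 \/ 6 <= #|V| by lia.
  have /card_gt0P[e] : 0 < #|~: (M1 :|: M2 :|: M3)|.
    by move: def; rewrite /uncovered; lia.
  rewrite !inE !negb_or => /andP[/andP[eM1 _] _].
  have [N pmN eN] := edge_in_matching e V4.
  have := defmin M1 M1 N pm1 pm1 pmN; rewrite /uncovered.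
  have cM1 : #|V| = #|M1|.*2.
    by rewrite -(sum_degIn_all ends) (eq_bigr _ (fun v _ => pm1 v)) sum1_card.
  have : e |: M1 \subset M1 :|: M1 :|: N.
    by rewrite setUid subUset sub1set inE eN orbT subsetUl.
  move/subset_leq_card; rewrite cardsU1 eM1.
  by have := cardsC (M1 :|: M1 :|: N); move: cE cM1 d4 V4; clear; lia.
by [].
Qed.

Variables M1 M2 M3 : {set E}.
Hypotheses (pm1 : perfect_matching ends M1) (pm2 : perfect_matching ends M2)
           (pm3 : perfect_matching ends M3).

Definition layer k := [set e | (e \in M1) + (e \in M2) + (e \in M3) == k].

(** The second equation compares two expressions for 3: the degree of [v], and the sum of its
    degrees in the three matchings, where layer [k] has weight [k]. *)
Lemma layer_degrees v :
  degIn ends (layer 0) v + degIn ends (layer 1) v +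
  degIn ends (layer 2) v + degIn ends (layer 3) v = 3 /\
  degIn ends (layer 0) v = degIn ends (layer 2) v + 2 * degIn ends (layer 3) v.
Proof.
have dE F : degIn ends F v = \sum_e (e \in F) * (((ends e).1 == v) + ((ends e).2 == v)).
  by rewrite degInE big_mkcond; apply: eq_bigr => e _; case: (e \in F); rewrite ?mul1n.
have sum3 : degIn ends (layer 0) v + degIn ends (layer 1) v +
    degIn ends (layer 2) v + degIn ends (layer 3) v = degIn ends setT v.
  rewrite !dE -!big_split; apply: eq_bigr => e _ /=; rewrite -!mulnDl !inE.
  by do 3!case: (_ \in _).
have sumM : degIn ends M1 v + degIn ends M2 v + degIn ends M3 v =
    degIn ends (layer 1) v + 2 * degIn ends (layer 2) v + 3 * degIn ends (layer 3) v.
  rewrite !dE !big_distrr -!big_split; apply: eq_bigr => e _ /=.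
  rewrite !mulnA -!mulnDl !inE.
  by do 3!case: (_ \in _).
rewrite cub in sum3; split=> //; move: sumM sum3; rewrite pm1 pm2 pm3; clear; lia.
Qed.

Lemma card_layers : #|layer 0| = #|layer 2| + 2 * #|layer 3|.
Proof.
suff : #|layer 0|.*2 = #|layer 2|.*2 + 2 * #|layer 3|.*2 by lia.
rewrite -!(sum_degIn_all ends) big_distrr -big_split; apply: eq_bigr => v _ /=.
by have [] := layer_degrees v.
Qed.

Lemma layer_disjoint j k e f : e \in layer j -> f \in layer k -> j != k -> e != f.
Proof. by rewrite !inE => /eqP<- /eqP<-; apply: contraNneq => ->. Qed.

Lemma degIn_gt0 (F : {set E}) e v : e \in F -> incident e v -> 0 < degIn ends F v.
Proof.
by move=> eF ev; have : v \in touched ends F; [apply/touchedP; exists e | rewrite inE lt0n].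
Qed.

Lemma degIn_gt0P F v : 0 < degIn ends F v -> exists2 e, e \in F & incident e v.
Proof. by rewrite lt0n => dv; apply/touchedP; rewrite inE. Qed.

Hypothesis V6 : 6 <= #|V|.

Lemma card_layer3 : #|layer 0| = 4 -> #|layer 3| <= 1.
Proof.
move=> c0; rewrite leqNgt; apply/negP => c3; have := card_layers.
move=> eq02; have L2 : layer 2 = set0 by apply/eqP; rewrite -cards_eq0; lia.
have {}c3 : #|layer 3| = 2 by lia.
pose X := touched ends (layer 3).
have d2 v : degIn ends (layer 2) v = 0.
  by rewrite L2 degInE big_set0.
(* A vertex of [X] has one edge in layer 3 and two in layer 0. Conversely, with layer 2 empty, any
   end of a layer 0 edge is in [X]; so no edge leaves [X]. *)
have in0 e v : incident e v -> v \in X -> e \in layer 0 \/ e \in layer 3.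
  rewrite inE => ev; have [] := layer_degrees v; rewrite d2 => sum3 eq0 v3.
  have [e1 | ] := boolP (e \in layer 1); first by have := degIn_gt0 e1 ev; lia.
  have [e2 | ] := boolP (e \in layer 2); first by have := degIn_gt0 e2 ev; rewrite d2.
  by rewrite !inE; do 3!case: (_ \in _); auto.
have closedX e u v : incident e u -> incident e v -> u \in X -> v \in X.
  move=> eu ev uX; rewrite inE; case: (in0 e u eu uX) => eL; last first.
    by have := degIn_gt0 eL ev; lia.
  by have := degIn_gt0 eL ev; have [_ ->] := layer_degrees v; rewrite d2; lia.
have bX : boundary ends X = set0.
  apply/setP => e; rewrite in_set0 inE.
  have -> : ((ends e).1 \in X) = ((ends e).2 \in X).
    by apply/idP/idP; apply: (closedX e); rewrite eqxx ?orbT.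
  by rewrite addbb.
have cX : #|X| = 4.
  have := sum_degIn_touched ends (layer 3); rewrite c3 -/X.
  rewrite (eq_bigr (fun=> 1)) ?sum1_card // => v; rewrite inE.
  by have [] := layer_degrees v; lia.
by apply: (no_small_cut cub cyc (X := X)); rewrite ?bX ?cards0 //; have := cardsC X; lia.
Qed.

(** * Pairing the uncovered edges through doubly covered ones *)

Definition meets e g := [exists v, incident e v && incident g v].

(** Each end of [g] carries exactly one layer 0 edge, and the two differ as there are no parallel
    edges. The matching among the three that misses [g] also misses both of them, so
    [matching_through_path] applies. *)
Lemma layer2_link g : g \in layer 2 ->
  exists e f, [/\ e \in layer 0, f \in layer 0, e != f,
    exists N, [/\ perfect_matching ends N, e \in N & f \in N] &
    forall h, h \in layer 0 -> meets h g -> (h == e) || (h == f)].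
Proof.
move=> gL; set a := (ends g).1; set b := (ends g).2.
have nab : a != b by apply: loopless; lia.
have ga : incident g a by rewrite eqxx.
have gb : incident g b by rewrite eqxx orbT.
have d0 v : incident g v -> degIn ends (layer 0) v = 1.
  by move=> gv; have := degIn_gt0 gL gv; have [] := layer_degrees v; lia.
have [|e eL ea] := @degIn_gt0P (layer 0) a; first by rewrite d0.
have [|f fL fb] := @degIn_gt0P (layer 0) b; first by rewrite d0.
have neg : e != g by apply: layer_disjoint eL gL _.
have nfg : f != g by apply: layer_disjoint fL gL _.
have nef : e != f.
  apply: contraNneq neg => eqef; rewrite -eqef in fb.
  by apply/eqP; apply: no_parallel nab ea fb ga gb; lia.
exists e, f; split=> //; last first.
  move=> h hL /existsP[v /andP[hv gv]].
  have le1 w : incident g w -> degIn ends (layer 0) w <= 1 by move/d0->.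
  case/orP: gv => /eqP gv; rewrite -gv in hv.
    by rewrite (degIn_unique (le1 _ ga) hL eL hv ea) eqxx.
  by rewrite (degIn_unique (le1 _ gb) hL fL hv fb) eqxx orbT.
have [M [pmM gM]] : exists M, perfect_matching ends M /\
    [/\ g \notin M, e \notin M & f \notin M].
  move: gL eL fL; rewrite !inE !addn_eq0 !eqb0 => gL /andP[/andP[e1 e2] e3] /andP[/andP[f1 f2] f3].
  have [g1|g1] := boolP (g \in M1); last by exists M1.
  have [g2|g2] := boolP (g \in M2); last by exists M2.
  by exists M3; split=> //; split=> //; move: gL; rewrite g1 g2; case: (g \in M3).
case: gM => gM eM fM.
exact: (matching_through_path cub cyc V6 pmM eM fM gM nef neg nfg nab ga gb ea fb).
Qed.

(** The two ends of [e] carry distinct edges of layer 2 or 3. If layer 3 is empty, [e] meets two of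
    the four layer 2 edges; if it has one edge, [e] meets at least one of two. *)
Lemma card_layer2_meets e : #|layer 0| = 4 -> e \in layer 0 ->
  #|layer 2| <= 2 * #|[set g in layer 2 | meets e g]|.
Proof.
move=> c0 eL; set A := [set g in layer 2 | _]; have le3 := card_layer3 c0.
have eq02 := card_layers.
have nbr v : incident e v -> exists2 g, incident g v & (g \in A) || (g \in layer 3).
  move=> ev; have := degIn_gt0 eL ev; have [_ ->] := layer_degrees v => d23.
  have [d2 | d2] := posnP (degIn ends (layer 2) v).
    have [|g gL gv] := @degIn_gt0P (layer 3) v; first by lia.
    by exists g; rewrite // gL orbT.
  have [g gL gv] := degIn_gt0P d2; exists g; rewrite // inE gL.
  by apply/orP; left; apply/existsP; exists v; rewrite ev gv.
have [|g g1 gL] := nbr (ends e).1; first by rewrite eqxx.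
have [|h h2 hL] := nbr (ends e).2; first by rewrite eqxx orbT.
have ne k : (k \in A) || (k \in layer 3) -> e != k.
  by rewrite inE => /orP[/andP[kL _]|kL]; apply: layer_disjoint eL kL _.
have ngh : g != h.
  apply: contraNneq (ne g gL) => eqgh; rewrite -eqgh in h2; apply/eqP.
  by apply: no_parallel (loopless e _) _ _ g1 h2; rewrite ?eqxx ?orbT //; lia.
have two (B : {set E}) : g \in B -> h \in B -> 1 < #|B|.
  move=> gB hB; have : [set g; h] \subset B by rewrite subUset !sub1set gB.
  by move/subset_leq_card; rewrite cards2 ngh.
have A_pos k : k \in A -> 0 < #|A| by move=> kA; apply/card_gt0P; exists k.
have L3_pos k : k \in layer 3 -> 0 < #|layer 3| by move=> kL; apply/card_gt0P; exists k.
move: (two A) (two (layer 3)) (A_pos g) (A_pos h) (L3_pos g) (L3_pos h) gL hL.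
rewrite c0 in eq02; move: le3 eq02 (g \in A) (h \in A) (g \in layer 3) (h \in layer 3).
by move: #|A| #|layer 2| #|layer 3|; clear; lia.
Qed.

Lemma cover_layer0 : #|layer 0| = 4 -> exists N N',
  [/\ perfect_matching ends N, perfect_matching ends N' & layer 0 \subset N :|: N'].
Proof.
move=> c0; have le3 := card_layer3 c0; have eq02 := card_layers.
have /card_gt0P[g gL] : 0 < #|layer 2| by lia.
have [e1 [e2 [e1L e2L ne12 [N [pmN e1N e2N]] gP]]] := layer2_link gL.
have s12 : [set e1; e2] \subset layer 0 by rewrite subUset !sub1set e1L.
have /cards2P[e3 [e4 [ne34 eq34]]] : #|layer 0 :\: [set e1; e2]| == 2.
  by rewrite cardsD (setIidPr s12) c0 cards2 ne12.
have in34 e : (e \in [set e3; e4]) = (e \notin [set e1; e2]) && (e \in layer 0).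
  by rewrite -eq34 inE.
have [e3n e3L] : e3 \notin [set e1; e2] /\ e3 \in layer 0.
  by apply/andP; rewrite -in34 !inE eqxx.
have [e4n e4L] : e4 \notin [set e1; e2] /\ e4 \in layer 0.
  by apply/andP; rewrite -in34 !inE eqxx orbT.
pose A e := [set h in layer 2 | meets e h].
(* Both sets contain at least half of layer 2 but avoid [g], whose only layer 0 neighbours are [e1]
   and [e2]; hence they intersect. *)
have /set0Pn[h /setIP[h3 h4]] : A e3 :&: A e4 != set0.
  apply/negP => /eqP disj; have := cardsUI (A e3) (A e4); rewrite disj cards0.
  have : A e3 :|: A e4 \subset layer 2 :\ g.
    have notg e : e \in layer 0 -> e \notin [set e1; e2] -> g \notin A e.
      by move=> eL; apply: contraNN => /setIdP[_ /(gP e eL)]; rewrite !inE.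
    by rewrite subsetD1 inE negb_or !notg // subUset /A !setIdE !subsetIl.
  move/subset_leq_card; have := cardsD1 g (layer 2); rewrite gL.
  have := card_layer2_meets c0 e3L; have := card_layer2_meets c0 e4L.
  by rewrite -/(A e3) -/(A e4); clear; lia.
case/setIdP: h3 => hL m3; case/setIdP: h4 => _ m4.
(* The edge [h] meets both [e3] and [e4], so these are among the two edges linked by [h] and lie in
   [N']. *)
have [e [f [eL fL nef [N' [pmN' eN' fN']] hP]]] := layer2_link hL.
exists N, N'; split=> //; apply/subsetP => k kL; rewrite inE.
have [] := boolP (k \in [set e1; e2]); first by rewrite !inE => /orP[]/eqP->; rewrite ?e1N ?e2N.
move=> kn; have : k \in [set e3; e4] by rewrite in34 kn.
have efN k' : (k' == e) || (k' == f) -> k' \in N' by case/orP=> /eqP->.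
by rewrite !inE => /orP[]/eqP->; rewrite efN ?orbT // hP.
Qed.
End Layers.

Theorem theorem5p3 (V E : finType) (ends : E -> V * V) :
  cubic ends -> cyclically_edge_connected ends 4 ->
  colouring_defect_is ends 4 ->
  berge_cover ends.
Proof.
move=> cub cyc defG; have V6 := order_ge6 cub cyc (leqnn 4) defG.
have [[M1 [M2 [M3 [pm1 pm2 pm3 def]]]] _] := defG.
have L0 : layer M1 M2 M3 0 = ~: (M1 :|: M2 :|: M3).
  by apply/setP => e; rewrite !inE; do 3!case: (_ \in _).
have [|N [N' [pmN pmN' covN]]] := cover_layer0 cub cyc pm1 pm2 pm3 V6; first by rewrite L0.
exists [:: M1; M2; M3; N; N']; split=> //; split=> [M | e].
  by rewrite !inE => /or4P[/eqP->|/eqP->|/eqP->|/orP[]/eqP->].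
have [e0 | ] := boolP (e \in layer M1 M2 M3 0).
  have := subsetP covN e e0; rewrite inE => /orP[eN | eN].
    by exists N; rewrite // !inE eqxx ?orbT.
  by exists N'; rewrite // !inE eqxx ?orbT.
rewrite L0 !inE negbK => /orP[/orP[]|] eM.
- by exists M1; rewrite // !inE eqxx ?orbT.
- by exists M2; rewrite // !inE eqxx ?orbT.
- by exists M3; rewrite // !inE eqxx ?orbT.
Qed.
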